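(* Let $m=\prod_{i=1}^s p_i^{k_i}$ be the prime factorization of $m$ (distinct primes $p_i$, $k_i\ge 1$), $R_m=\mathbb{Z}/m\mathbb{Z}$, $R_i=\mathbb{Z}/p_i^{k_i}\mathbb{Z}$, and let $\Theta:R_m\xrightarrow{\sim}\prod_{i=1}^s R_i$ be the Chinese Remainder isomorphism. Let $\mathrm{End}_{\mathrm{cp}}(R)$ denote the set of congruence-preserving maps $R\to R$. Then there is a bijection $$\mathrm{End}_{\mathrm{cp}}(R_m)\cong\prod_{i=1}^s \mathrm{End}_{\mathrm{cp}}(R_i)$$ induced by $\Theta$, $f\mapsto(f_1,\dots,f_s)$ with $f=\Theta^{-1}\circ(f_1\times\cdots\times f_s)\circ\Theta$. For any such $f$, its functional graph $G_f$ is isomorphic to the direct product of the functional graphs of its components: $$G_f\cong G_{f_1}\times G_{f_2}\times\cdots\times G_{f_s}.$$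
   Context: For $n\ge 1$, a map of sets $f:\mathbb{Z}/n\mathbb{Z}\to\mathbb{Z}/n\mathbb{Z}$ (not necessarily a homomorphism) is congruence-preserving if for every divisor $d\mid n$ and all $x,y\in\mathbb{Z}/n\mathbb{Z}$, $x\equiv y\pmod d$ implies $f(x)\equiv f(y)\pmod d$. The functional graph $G_f$ of $f:X\to X$ is the directed graph with vertex set $X$ and edges $(x,f(x))$, $x\in X$. The direct product $G_{f_1}\times G_{f_2}$ of functional graphs of $f_j:X_j\to X_j$ is the functional graph with vertex set $X_1\times X_2$ and edges $((x_1,x_2),(f_1(x_1),f_2(x_2)))$; similarly for finitely many factors. *)

(* Defs.v *)
From HB Require Import structures.
From mathcomp Require Import all_boot all_order all_algebra.

Set Implicit Arguments.
Unset Strict Implicit.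
Unset Printing Implicit Defensive.

Import GRing.Theory.
Local Open Scope ring_scope.

(* The ring Z/nZ for n >= 1, an element being its representative in [0, n).
   The library's 'Z_n is not used because it denotes Z/2Z when n = 1, and the
   trivial ring is needed here (m = 1 is the empty product).  For n >= 1,
   n.-1.+1 = n; the junk value n = 0 gives the trivial ring. *)
Definition Zmod (n : nat) : Type := 'I_n.-1.+1.

HB.instance Definition _ n := Finite.copy (Zmod n) 'I_n.-1.+1.
HB.instance Definition _ n := GRing.Zmodule.copy (Zmod n) 'I_n.-1.+1.
HB.instance Definition _ n :=
  GRing.Zmodule_isComPzRing.Build (Zmod n)
    (@Zp_mulA n.-1.+1) (@Zp_mulC _) (@Zp_mul1z _) (@Zp_mul_addl _).

Definition rep (n : nat) (x : Zmod n) : nat := nat_of_ord x.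
Definition class_of (n a : nat) : Zmod n := inZp a.

Lemma class_ofE n a : (0 < n)%N -> rep (class_of n a) = (a %% n)%N.
Proof. by case: n. Qed.

Lemma rep_lt n (x : Zmod n) : (0 < n)%N -> (rep x < n)%N.
Proof. by case: n x => // n x _; apply: ltn_ord. Qed.

Lemma rep_inj n : injective (@rep n).
Proof. exact: val_inj. Qed.

Lemma repK n : cancel (@rep n) (class_of n).
Proof. by move=> x; apply: valZpK. Qed.

Lemma repD n (x y : Zmod n) : (0 < n)%N -> rep (x + y) = ((rep x + rep y) %% n)%N.
Proof. by case: n x y. Qed.

Lemma repM n (x y : Zmod n) : (0 < n)%N -> rep (x * y) = ((rep x * rep y) %% n)%N.
Proof. by case: n x y. Qed.

Lemma rep1 n : (0 < n)%N -> rep (1 : Zmod n) = (1 %% n)%N.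
Proof. by case: n. Qed.

Lemma class_of_nat n a : class_of n a = a%:R.
Proof.
elim: a => [|a IHa]; first by apply: val_inj; rewrite /= mod0n.
by rewrite -natr1 -IHa; apply: val_inj; rewrite /= modnDm addn1.
Qed.

Definition congruence_preserving (n : nat) (f : Zmod n -> Zmod n) : Prop :=
  forall d, (d %| n)%N -> forall x y : Zmod n,
    rep x = rep y %[mod d] -> rep (f x) = rep (f y) %[mod d].

Definition congruence_preservingb (n : nat) (f : Zmod n -> Zmod n) : bool :=
  [forall d : 'I_n.+1, (d %| n)%N ==> [forall x : Zmod n, forall y : Zmod n,
    (rep x == rep y %[mod d])%N ==> (rep (f x) == rep (f y) %[mod d])%N]].

Lemma congruence_preservingP n (f : Zmod n -> Zmod n) : (0 < n)%N ->
  reflect (congruence_preserving f) (congruence_preservingb f).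
Proof.
move=> n_gt0; apply: (iffP forallP) => [fP d dvd_dn x y exy | fP d].
  have lt_dn : (d < n.+1)%N by rewrite ltnS dvdn_leq.
  have /implyP/(_ dvd_dn)/forallP/(_ x)/forallP/(_ y) := fP (Ordinal lt_dn).
  by move=> /implyP H; apply/eqP/H/eqP.
apply/implyP=> dvd_dn; apply/forallP=> x; apply/forallP=> y.
by apply/implyP=> /eqP exy; apply/eqP/fP.
Qed.

(* Maps are finite functions and the predicate is boolean, so that two elements
   of [End_cp n] are equal exactly when they agree as maps. *)
Definition End_cp (n : nat) : Type :=
  {f : {ffun Zmod n -> Zmod n} | congruence_preservingb f}.
HB.instance Definition _ n := Finite.on (End_cp n).

Definition map_of (n : nat) (f : End_cp n) : Zmod n -> Zmod n := val f.

Section ProductMap.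
Variables (I : finType) (X : I -> finType).

Definition prod_map (f : forall i, X i -> X i) (x : {dffun forall i, X i}) :
  {dffun forall i, X i} := [ffun i => f i (x i)].

End ProductMap.

Record digraph := Digraph { vertex : finType; edge : rel vertex }.

Definition digraph_iso (G H : digraph) : Prop :=
  exists2 phi : vertex G -> vertex H, bijective phi
    & forall x y, edge (phi x) (phi y) = edge x y.

Definition functional_graph (X : finType) (f : X -> X) : digraph :=
  Digraph (frel f).

Definition direct_product (I : finType) (G : I -> digraph) : digraph :=
  @Digraph {dffun forall i, vertex (G i)}
    (fun x y => [forall i, edge (x i) (y i)]).

(* The edges of the direct product of functional graphs are exactly the pairs
   ((x_i)_i, (f_i (x_i))_i). *)
Lemma direct_product_functional (I : finType) (X : I -> finType)
    (f : forall i, X i -> X i) (x y : {dffun forall i, X i}) :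
  @edge (direct_product (fun i => functional_graph (f i))) x y
    = @edge (functional_graph (prod_map f)) x y.
Proof.
apply/forallP/eqP => [fxy | <- i /=]; last by rewrite ffunE.
by apply/ffunP=> i; rewrite ffunE; apply/eqP/fxy.
Qed.

Section ChineseRemainder.
Variables (m s : nat) (q : 'I_s -> nat).

Definition Theta (x : Zmod m) : {dffun forall i, Zmod (q i)} :=
  [ffun i => class_of (q i) (rep x)].

(* The inverse function of [Theta]: the default value 0 is never taken when
   [Theta] is bijective (lemmas [ThetaK] and [Theta_invK]). *)
Definition Theta_inv (y : {dffun forall i, Zmod (q i)}) : Zmod m :=
  odflt 0 [pick x | Theta x == y].

Hypotheses (q_gt0 : forall i, (0 < q i)%N) (mE : m = (\prod_i q i)%N).
Hypothesis q_coprime : forall i j, i != j -> coprime (q i) (q j).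

Let m_gt0 : (0 < m)%N.
Proof. by rewrite mE prodn_gt0. Qed.

Let q_dvd i : (q i %| m)%N.
Proof. by rewrite mE (bigD1 i) //= dvdn_mulr. Qed.

Lemma Theta_inj : injective Theta.
Proof.
move=> x y exy.
have exyi i : (rep x == rep y %[mod q i])%N.
  by have /ffunP/(_ i) := exy; rewrite !ffunE => /(congr1 (@rep _));
     rewrite !class_ofE // => ->.
suff : (rep x == rep y %[mod m])%N.
  by rewrite !modn_small ?rep_lt // => /eqP/rep_inj.
move: (rep x) (rep y) exyi => a b exyi.
rewrite mE; have: uniq (index_enum 'I_s) by apply: index_enum_uniq.
elim: (index_enum 'I_s) => [_|i r IHr /=/andP[ir ur]].
  by rewrite big_nil !modn1.
rewrite big_cons chinese_remainder ?exyi ?IHr //.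
elim: r ir {IHr ur} => [|j r IHr]; first by rewrite big_nil coprimen1.
by rewrite inE negb_or big_cons coprimeMr => /andP[/q_coprime-> /IHr].
Qed.

Lemma Theta_bij : bijective Theta.
Proof.
apply: inj_card_bij; first exact: Theta_inj.
rewrite card_dep_ffun foldrE big_map big_enum /= card_ord prednK //.
rewrite mE leq_prod // => i _; by rewrite card_ord prednK.
Qed.

Lemma ThetaK : cancel Theta Theta_inv.
Proof.
move=> x; rewrite /Theta_inv; case: pickP => [z /eqP/Theta_inj //|/(_ x)].
by rewrite eqxx.
Qed.

Lemma Theta_invK : cancel Theta_inv Theta.
Proof. by case: Theta_bij => g _ gK y; rewrite -[y]gK ThetaK. Qed.

Let class_of_rep i (x : Zmod m) a :
  rep x = (a %% m)%N -> class_of (q i) (rep x) = class_of (q i) a.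
Proof.
by move=> ->; apply: rep_inj; rewrite !class_ofE // modn_dvdm.
Qed.

(* [Theta] is a ring isomorphism, the ring operations of the product being
   componentwise. *)
Lemma ThetaD x y i : Theta (x + y) i = Theta x i + Theta y i.
Proof.
rewrite !ffunE !class_of_nat -natrD -!class_of_nat; apply: class_of_rep.
exact: repD.
Qed.

Lemma ThetaM x y i : Theta (x * y) i = Theta x i * Theta y i.
Proof.
rewrite !ffunE !class_of_nat -natrM -!class_of_nat; apply: class_of_rep.
exact: repM.
Qed.

Lemma Theta1 i : Theta 1 i = 1.
Proof.
rewrite ffunE -[RHS]/(1%:R) -class_of_nat; apply: class_of_rep.
exact: rep1.
Qed.

End ChineseRemainder.

(* Main.v *)
Require Import Defs.
From mathcomp Require Import all_boot all_order all_algebra.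

Set Implicit Arguments.
Unset Strict Implicit.
Unset Printing Implicit Defensive.

(** Let [q_i] be pairwise coprime with product [m].  A congruence-preserving map
    [f] of Z/mZ preserves congruence modulo [q_i] in particular, so it descends
    along the projection Z/mZ -> Z/q_iZ to a map [f_i] ([residue_mapE]), and
    [f_i] inherits the congruences modulo the divisors of [q_i], which divide
    [m].  Thus [Theta] conjugates [f] to the product of the [f_i] ([Theta_map]).
    As [Theta] is bijective, this says both that [f] is recovered from its
    components and that [Theta] is an isomorphism of functional graphs.

    Conversely, any family of congruence-preserving maps [g_i] glues to
    [Theta^-1 o prod g_i o Theta].  The point to prove is that the glued map
    preserves congruence modulo an arbitrary divisor [d] of [m], although each
    [g_i] only sees the divisors of [q_i].  This holds because [d] divides the
    product of the [gcd(d, q_i)], and these are pairwise coprime: a congruence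
    modulo [d] is therefore the conjunction of the congruences modulo the
    [gcd(d, q_i)] ([eqn_mod_gcd_prod]), to each of which one [g_i] applies.
    Since every element of Z/q_iZ is the residue of an element of Z/mZ, the
    components of the glued map are the [g_i] again. *)

(** Two factors at a time: [gcd(d, a) gcd(d, b)] is the gcd of [d^2], [d b],
    [a d] and [a b], all of which are multiples of [gcd(d, a b)]. *)
Lemma dvdn_gcd_prod (I : Type) (r : seq I) (q : I -> nat) d :
  d %| \prod_(i <- r) q i -> d %| \prod_(i <- r) gcdn d (q i).
Proof.
have gcd_mul a b : gcdn d (a * b) %| gcdn d a * gcdn d b.
  rewrite muln_gcdl !muln_gcdr !dvdn_gcd dvdn_gcdr andbT.
  by rewrite !(dvdn_mulr _ (dvdn_gcdl _ _)) dvdn_mull ?dvdn_gcdl.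
suff gcd_prod : gcdn d (\prod_(i <- r) q i) %| \prod_(i <- r) gcdn d (q i).
  by move=> /gcdn_idPl {1}<-.
elim: r => [|i r IHr]; first by rewrite !big_nil gcdn1.
rewrite !big_cons; apply: dvdn_trans (gcd_mul _ _) _.
by rewrite dvdn_mul.
Qed.

(** The uniqueness half of the Chinese remainder theorem, by adding one modulus
    at a time, coprime to the product of the others. *)
Lemma eqn_mod_prod (I : finType) (q : I -> nat) a b :
    (forall i j, i != j -> coprime (q i) (q j)) ->
    (forall i, a = b %[mod q i]) ->
  a = b %[mod \prod_i q i].
Proof.
move=> q_coprime eq_ab; apply/eqP.
have: uniq (index_enum I) by apply: index_enum_uniq.
elim: (index_enum I) => [_ | i r IHr /= /andP[i_r /IHr{}IHr]].
  by rewrite big_nil !modn1.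
rewrite big_cons chinese_remainder ?eq_ab ?eqxx //.
elim: r i_r {IHr} => [|j r IHr]; first by rewrite big_nil coprimen1.
by rewrite inE negb_or big_cons coprimeMr => /andP[/q_coprime-> /IHr].
Qed.

(** The form of the Chinese remainder theorem that makes gluing possible: it
    replaces the divisor [d] of the product, on which no single factor has
    control, by the divisors [gcd(d, q_i)] of the individual factors. *)
Lemma eqn_mod_gcd_prod (I : finType) (q : I -> nat) d a b :
    (forall i j, i != j -> coprime (q i) (q j)) ->
    d %| \prod_i q i ->
    (forall i, a = b %[mod gcdn d (q i)]) ->
  a = b %[mod d].
Proof.
move=> q_coprime /dvdn_gcd_prod d_dvd eq_ab.
rewrite -(modn_dvdm a d_dvd) -(modn_dvdm b d_dvd).
rewrite (@eqn_mod_prod _ (fun i => gcdn d (q i)) a b) // => i j /q_coprime co_ij.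
apply: coprime_dvdl (dvdn_gcdr _ _) _.
exact: coprime_dvdr (dvdn_gcdr _ _) co_ij.
Qed.

Lemma rep_class_of_mod d n a : 0 < n -> d %| n ->
  rep (class_of n a) = a %[mod d].
Proof. by move=> n_gt0 d_n; rewrite class_ofE // modn_dvdm. Qed.

Lemma eq_class_of n a b : 0 < n ->
  a = b %[mod n] -> class_of n a = class_of n b.
Proof. by move=> n_gt0 eq_ab; apply: rep_inj; rewrite !class_ofE. Qed.

Lemma map_ofP n (f : End_cp n) : 0 < n -> congruence_preserving (map_of f).
Proof. by move=> n_gt0; apply/congruence_preservingP=> //; apply: (valP f). Qed.

Lemma End_cp_inj n (f g : End_cp n) : map_of f =1 map_of g -> f = g.
Proof. by move=> eq_fg; apply/val_inj/ffunP. Qed.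

Lemma finfun_cp n (f : Zmod n -> Zmod n) : 0 < n ->
  congruence_preserving f -> congruence_preservingb (finfun f).
Proof.
move=> n_gt0 fP; apply/congruence_preservingP=> // d d_n x y.
by rewrite !ffunE; apply: fP.
Qed.

Definition cp_End n (n_gt0 : 0 < n) (f : Zmod n -> Zmod n)
    (fP : congruence_preserving f) : End_cp n :=
  exist _ (finfun f) (finfun_cp n_gt0 fP).

Lemma cp_EndE n (n_gt0 : 0 < n) f (fP : congruence_preserving f) :
  map_of (cp_End n_gt0 fP) =1 f.
Proof. by move=> x; rewrite /map_of /= ffunE. Qed.

(** For congruence-preserving [f] and [q] dividing [m], this is the map that
    [f] induces on the quotient Z/qZ of Z/mZ. *)
Definition residue_map m q (f : Zmod m -> Zmod m) (y : Zmod q) : Zmod q :=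
  class_of q (rep (f (class_of m (rep y)))).

Section Residue.

Variables (m q : nat).
Hypotheses (m_gt0 : 0 < m) (q_dvd : q %| m).

Let q_gt0 : 0 < q. Proof. exact: dvdn_gt0 q_dvd. Qed.

Lemma class_of_lift (y : Zmod q) :
  class_of q (rep (class_of m (rep y))) = y.
Proof.
rewrite -[RHS]repK; apply: eq_class_of; first exact: q_gt0.
exact: rep_class_of_mod.
Qed.

Lemma residue_map_cp (f : Zmod m -> Zmod m) :
  congruence_preserving f -> congruence_preserving (@residue_map m q f).
Proof.
move=> fP d d_q x y eq_xy; have d_m := dvdn_trans d_q q_dvd.
by rewrite !rep_class_of_mod //; apply: fP; rewrite // !rep_class_of_mod.
Qed.

(** The result does not depend on the lift: replacing [x] by the least
    representative of its class modulo [q] changes [f x] by a multiple of [q]. *)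
Lemma residue_mapE (f : Zmod m -> Zmod m) x : congruence_preserving f ->
  residue_map f (class_of q (rep x)) = class_of q (rep (f x)).
Proof.
move=> fP; apply: eq_class_of; first exact: q_gt0.
by apply: fP => //; rewrite !rep_class_of_mod.
Qed.

End Residue.

Section Split.

Variables (m s : nat) (q : 'I_s -> nat).
Hypotheses (q_gt0 : forall i, 0 < q i) (mE : m = \prod_i q i).
Hypothesis q_coprime : forall i j, i != j -> coprime (q i) (q j).

Let m_gt0 : 0 < m. Proof. by rewrite mE prodn_gt0. Qed.

Let q_dvd i : q i %| m. Proof. by rewrite mE (bigD1 i) //= dvdn_mulr. Qed.

Local Notation Theta := (@Theta m s q).
Local Notation Theta_inv := (@Theta_inv m s q).

Definition split_End (f : End_cp m) : {dffun forall i, End_cp (q i)} :=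
  [ffun i => cp_End (q_gt0 i)
     (residue_map_cp m_gt0 (q_dvd i) (map_ofP f m_gt0))].

Definition glue (g : {dffun forall i, End_cp (q i)}) : Zmod m -> Zmod m :=
  Theta_inv \o prod_map (fun i => map_of (g i)) \o Theta.

(** The equation [Theta o f = (prod f_i) o Theta]: composed with [Theta^-1] it
    recovers [f] from its components, and it carries edges to edges. *)
Lemma Theta_map f x :
  Theta (map_of f x)
    = prod_map (fun i => map_of (split_End f i)) (Theta x).
Proof.
apply/ffunP=> i; rewrite !ffunE cp_EndE residue_mapE //.
exact: map_ofP.
Qed.

Lemma Theta_glue g x :
  Theta (glue g x) = prod_map (fun i => map_of (g i)) (Theta x).
Proof. exact: Theta_invK. Qed.

(** Modulo [gcd(d, q_i)], which divides both [d] and [q_i], the hypothesis on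
    [x] and [y] survives and the glued map is given by [g i] alone. *)
Lemma glue_cp g : congruence_preserving (glue g).
Proof.
move=> d d_m x y eq_xy; apply: (@eqn_mod_gcd_prod _ q) => // [|i].
  by rewrite -mE.
set e := gcdn d (q i); have e_q : e %| q i by apply: dvdn_gcdr.
have glue_mod z :
    rep (glue g z) = rep (map_of (g i) (class_of (q i) (rep z))) %[mod e].
  have /ffunP/(_ i) := Theta_glue g z; rewrite !ffunE => <-.
  by rewrite rep_class_of_mod.
rewrite !glue_mod; apply: (map_ofP _ (q_gt0 i)) => //.
rewrite !rep_class_of_mod //.
by rewrite -(modn_dvdm (rep x) (dvdn_gcdl d (q i))) eq_xy modn_dvdm ?dvdn_gcdl.
Qed.

Definition glue_End g : End_cp m := cp_End m_gt0 (@glue_cp g).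

Lemma glue_split f : glue (split_End f) =1 map_of f.
Proof. by move=> x; rewrite /glue /= -Theta_map ThetaK. Qed.

Lemma split_EndK : cancel split_End glue_End.
Proof. by move=> f; apply: End_cp_inj => x; rewrite cp_EndE glue_split. Qed.

Lemma glue_EndK : cancel glue_End split_End.
Proof.
move=> g; apply/ffunP=> i; apply: End_cp_inj => y.
(* [y] is the [i]-th residue of its lift [x] to Z/mZ, and there the [i]-th
   coordinates of the two expressions for [Theta (glue g x)] can be compared. *)
pose x : Zmod m := class_of m (rep y).
have Theta_x : Theta x i = y by rewrite ffunE class_of_lift.
have /ffunP/(_ i) := Theta_map (glue_End g) x.
by rewrite cp_EndE Theta_glue [LHS]ffunE [RHS]ffunE Theta_x.
Qed.

Lemma split_End_bij : bijective split_End.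
Proof. by exists glue_End; [apply: split_EndK | apply: glue_EndK]. Qed.

Lemma functional_graph_split f :
  digraph_iso (functional_graph (map_of f))
    (direct_product (fun i => functional_graph (map_of (split_End f i)))).
Proof.
exists Theta; first exact: Theta_bij.
move=> x y; rewrite direct_product_functional /= -Theta_map.
by rewrite (inj_eq (Theta_inj q_gt0 mE q_coprime)).
Qed.

End Split.

Theorem theorem7p18 (m s : nat) (p k : 'I_s -> nat)
    (p_prime : forall i, prime (p i))
    (p_inj : injective p)
    (k_gt0 : forall i, 0 < k i)
    (mE : m = \prod_(i < s) p i ^ k i) :
  exists Phi : End_cp m -> {dffun forall i : 'I_s, End_cp (p i ^ k i)},
    [/\ bijective Phi,
        forall f : End_cp m,
          map_of f =1
            @Theta_inv m s (fun i => p i ^ k i)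
              \o prod_map (fun i => map_of (Phi f i))
              \o @Theta m s (fun i => p i ^ k i)
      & forall f : End_cp m,
          digraph_iso (functional_graph (map_of f))
            (direct_product (fun i => functional_graph (map_of (Phi f i))))].
Proof.
have q_gt0 i : 0 < p i ^ k i by rewrite expn_gt0 prime_gt0.
have q_coprime i j : i != j -> coprime (p i ^ k i) (p j ^ k j).
  move=> ne_ij; apply/coprimeXl/coprimeXr.
  by rewrite prime_coprime // dvdn_prime2 // (inj_eq p_inj).
exists (split_End q_gt0 mE); split.
- exact: split_End_bij.
- by move=> f x; rewrite -(glue_split q_gt0 mE q_coprime).
- exact: functional_graph_split.
Qed.
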